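(* Let $E \ge G \ge 1$ be integers and put $x = E - G$. By drawing the $E$-sided directed polygon with numbered vertices (the directed cycle with vertices numbered $1,\dots,E$ and arrows $1\to 2\to\cdots\to E\to 1$) and operating on it $x = E-G$ times with the pinching operation $C(i,j)$, for different pairs $(i,j)$, every toric quiver diagram with $G$ nodes and $E$ arrows is generated, up to isomorphism of directed multigraphs.
   Context: A quiver diagram is a finite directed multigraph; multiple arrows between the same nodes and arrows from a node to itself (self-adjoint loops) are allowed. A toric quiver diagram is a quiver diagram satisfying the Calabi-Yau condition: at every node the indegree (number of arrows entering) equals the outdegree (number of arrows leaving), where an arrow from a node to itself counts once in each. Two quiver diagrams are isomorphic if some relabeling of nodes (respecting the multiplicities of arrows) makes them identical. Pinching operation: $C(i,j)$ pinches the graph between the nodes labeled $i$ and $j$, i.e. identifies these two nodes, keeping all arrows (so arrows between the two identified nodes become loops at the new node). The resulting node carries simultaneously all labels of both identified nodes, so subsequent operations may refer to it by any of its labels. Each operation is applied to a pair of labels $(i,j)$ that currently label two distinct nodes, so that each application reduces the number of nodes by one and leaves the number of arrows unchanged; after $x$ operations there are $E-x=G$ nodes and $E$ arrows. For $E=1$ the polygon is a single node with one loop, and for $E=2$ it is two nodes with one arrow in each direction.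
   Formalization: The toric quiver diagram is additionally assumed connected (as an undirected graph); without this the claim fails, e.g. for E = G = 2 and two nodes each carrying one loop, and it fails for every disconnected diagram since pinching a polygon keeps it connected. *)

(* Defs.v *)
From mathcomp Require Import all_boot.

Set Implicit Arguments.
Unset Strict Implicit.
Unset Printing Implicit Defensive.

(* A finite directed multigraph, with possible parallel arrows and loops. *)
Record quiver := Quiver {
  node : finType;
  arrow : finType;
  src : arrow -> node;
  tgt : arrow -> node
}.

Section QuiverTheory.
Variable Q : quiver.

Definition mult (u v : node Q) : nat :=
  #|[set a : arrow Q | (src a == u) && (tgt a == v)]|.

(* A loop at [v] contributes one to each of these two degrees. *)
Definition indeg (v : node Q) : nat := #|[set a : arrow Q | tgt a == v]|.
Definition outdeg (v : node Q) : nat := #|[set a : arrow Q | src a == v]|.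

(* The Calabi-Yau condition. *)
Definition toric : Prop := forall v : node Q, indeg v = outdeg v.

Definition adjacent : rel (node Q) :=
  [rel u v | (0 < mult u v) || (0 < mult v u)].

(* Connectedness of the underlying undirected graph; it does not follow from
   [toric], since a disjoint union of toric quivers is toric. *)
Definition connected_quiver : Prop := forall u v : node Q, connect adjacent u v.

End QuiverTheory.

Definition isomorphic (Q1 Q2 : quiver) : Prop :=
  exists2 f : node Q1 -> node Q2, bijective f &
    forall u v : node Q1, mult (f u) (f v) = mult u v.

(* [label] need not be injective: a node carries all the labels in its fibre. *)
Record labelled_quiver (L : Type) := LabelledQuiver {
  quiver_of :> quiver;
  label : L -> node quiver_of
}.

(* The E vertices 1, ..., E are represented by 0, ..., E - 1. *)
Definition polygon (E : nat) : labelled_quiver 'I_E :=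
  @LabelledQuiver 'I_E (@Quiver 'I_E 'I_E id (@ordS E)) id.

(* The set T with its distinct points u and v identified is represented by T
   with v removed, and [identify] is the quotient map, which sends v to u. *)
Definition identify (T : finType) (u v : T) (uv : u != v) (w : T) :
  {z : T | z != v} := insubd (exist _ u uv) w.

Definition pinch (L : Type) (P : labelled_quiver L) (i j : L)
    (ij : label P i != label P j) : labelled_quiver L :=
  @LabelledQuiver L
    (@Quiver {z : node P | z != label P j} (arrow P)
       (fun a => identify ij (src a)) (fun a => identify ij (tgt a)))
    (fun l => identify ij (label P l)).

(* [pinches P s P']: performing on P the operations C(i, j), for (i, j)
   running through s from left to right, is legitimate and yields P'. *)
Inductive pinches (L : Type) (P : labelled_quiver L) :
    seq (L * L) -> labelled_quiver L -> Prop :=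
| pinches_nil : pinches P [::] P
| pinches_rcons s P' i j (ij : label P' i != label P' j) :
    pinches P s P' -> pinches P (rcons s (i, j)) (pinch ij).

(* Main.v *)
Require Import Defs.
From mathcomp Require Import all_boot.
From mathcomp Require Import fingroup perm.

(** A connected toric quiver has an Eulerian circuit, which labels its arrows
    by the arrows of the polygon, and the quiver is the quotient of the polygon
    obtained by identifying the vertices at which the circuit visits the same
    node; each pinching performs one such identification.

    For the circuit, call a permutation s of the arrows a succession if s a
    always starts where a ends; successions exist since indegrees and outdegrees
    agree. If two arrows ending at the same node lie in different cycles of s,
    composing s with their transposition merges these cycles. So in a
    succession with the fewest cycles the arrows ending at a node all lie in one
    cycle, and by connectedness there is only one cycle. *)

(** Each node occurs equally often in the lists of targets and of sources of all arrows, so these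
    lists differ by a permutation [p] of positions, which is transported to the arrows. *)
Lemma toric_succession {Q : quiver} : toric Q ->
  exists s : {perm arrow Q}, forall a, src (s a) = tgt a.
Proof.
move=> hQ.
have countE (f : arrow Q -> node Q) v :
    count_mem v (codom f) = #|[set a | f a == v]|.
  by rewrite cardsE cardE /enum_mem size_filter count_map enumT; apply: eq_count.
have /tuple_permP[p /= Ep] : perm_eq (codom_tuple (@tgt Q)) (codom_tuple (@src Q)).
  by apply/allP => v _ /=; rewrite !countE; apply/eqP/hQ.
have pP i : src (enum_val (p i)) = tgt (enum_val i).
  have tnth_codom f j : tnth (codom_tuple f) j = f (enum_val j) :> node Q.
    by rewrite tnth_map (tnth_nth (enum_val j)) /= -enum_val_nth.
  rewrite -!tnth_codom.
  have -> : codom_tuple (@tgt Q) = [tuple tnth (codom_tuple (@src Q)) (p i) | i < _].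
    exact/val_inj.
  by rewrite tnth_mktuple.
have inj_s : injective (fun a : arrow Q => enum_val (p (enum_rank a))).
  by move=> a b /enum_val_inj/perm_inj/enum_rank_inj.
by exists (perm inj_s) => a; rewrite permE pP enum_rankK.
Qed.

Lemma adjacentP {Q : quiver} {u v : node Q} :
  reflect (exists a : arrow Q,
             (src a = u /\ tgt a = v) \/ (src a = v /\ tgt a = u))
          (adjacent u v).
Proof.
apply: (iffP orP) => [[]|[a [] [su tv]]].
- by case/card_gt0P => a; rewrite inE => /andP[/eqP su /eqP tv]; exists a; left.
- by case/card_gt0P => a; rewrite inE => /andP[/eqP sv /eqP tu]; exists a; right.
- by left; apply/card_gt0P; exists a; rewrite inE su tv !eqxx.
- by right; apply/card_gt0P; exists a; rewrite inE su tv !eqxx.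
Qed.

Lemma toric_cyclic_succession {Q : quiver} : toric Q -> connected_quiver Q ->
  exists2 s : {perm arrow Q}, forall a, src (s a) = tgt a &
    forall a b, b \in porbit s a.
Proof.
move=> hQ hconn; have [s0 s0P] := toric_succession hQ.
pose succession (s : {perm arrow Q}) := [forall a, src (s a) == tgt a].
have s0S : succession s0 by apply/forallP => a; apply/eqP.
case: (arg_minnP (fun s => #|porbits s|) s0S) => s /forallP sS s_min.
have sP a : src (s a) = tgt a by apply/eqP.
exists s => // a0.
have tgt_porbit a b : tgt a = tgt b -> a \in porbit s b.
  move=> tab; apply/negPn/negP => ab.
  have tS : succession (tperm a b * s)%g.
    apply/forallP => c; rewrite permM sP.
    by case: tpermP => [->|->|//]; rewrite tab.
  have := s_min _ tS; rewrite leqNgt => /negP; apply.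
  (* Since [a] and [b] lie in different cycles, the composite has exactly one cycle fewer. *)
  have := porbits_mul_tperm s a b; rewrite /= ab.
  have -> : a != b by apply: contraNneq ab => ->; apply: porbit_id.
  by rewrite addn2 addn1 => -[<-].
have orbS a : (s a \in porbit s a0) = (a \in porbit s a0).
  by rewrite -!eq_porbit_mem (porbit_perm s 1).
have orb_trans a b : a \in porbit s b -> b \in porbit s a0 -> a \in porbit s a0.
  by rewrite -!eq_porbit_mem => /eqP ->.
pose full v := forall a, tgt a = v -> a \in porbit s a0.
(* By [tgt_porbit], one arrow ending at [v] in the cycle of [a0] suffices: [e] itself if it enters
   [v], and its predecessor under [s] if it leaves [v]. *)
have fullS u v : adjacent u v -> full u -> full v.
  case/adjacentP => e [[su tv]|[sv tu]] u_full a ta.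
    have e_orb : e \in porbit s a0.
      by rewrite -[e](permKV s) orbS u_full // -sP permKV.
    by apply: orb_trans e_orb; apply: tgt_porbit; rewrite tv.
  have e_orb : (s^-1)%g e \in porbit s a0 by rewrite -orbS permKV u_full.
  by apply: orb_trans e_orb; apply: tgt_porbit; rewrite ta -sP permKV sv.
have full0 : full (tgt a0) by move=> a; apply: tgt_porbit.
move=> b; have /connectP[p p_path tb] := hconn (tgt a0) (tgt b).
suff: full (tgt b) by apply.
rewrite {}tb; elim: p (tgt a0) full0 p_path => //= v p IHp u u_full /andP[uv].
exact/IHp/(fullS u).
Qed.

Lemma eulerian_circuit {Q : quiver} {E : nat} :
  toric Q -> connected_quiver Q -> #|arrow Q| = E -> 0 < E ->
  exists2 c : 'I_E -> arrow Q, bijective c &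
    forall i, tgt (c i) = src (c (ordS i)).
Proof.
move=> hQ hconn cardE E_gt0.
have /card_gt0P[a0 _] : 0 < #|arrow Q| by rewrite cardE.
have [s sP s_cyc] := toric_cyclic_succession hQ hconn.
have card_orb : #|porbit s a0| = E.
  by rewrite -cardE; apply: eq_card => b; rewrite s_cyc.
pose c (i : 'I_E) := iter i s a0.
have c_surj b : exists i, c i == b.
  have := s_cyc a0 b; rewrite porbit_traject card_orb => /trajectP[i i_lt ->].
  by exists (Ordinal i_lt); apply/eqP.
exists c.
  have gK : cancel (fun b => xchoose (c_surj b)) c.
    by move=> b; apply/eqP/(xchooseP (c_surj b)).
  apply: (bij_can_bij _ gK); apply: inj_card_bij (can_inj gK) _.
  by rewrite card_ord cardE.
move=> i; rewrite -sP; congr src; rewrite /c /=.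
(* At the last index [ordS] wraps around to 0, and the circuit closes because the cycle of [a0] has
   length [E]. *)
have [iE|iE] := eqVneq i.+1 E; last first.
  by rewrite modn_small // ltn_neqAle iE /=.
by rewrite -iterS iE modnn /= -card_orb iter_porbit.
Qed.

(** By connectedness [v] is the source of [a0] or an endpoint of some arrow; if that arrow enters
    [v], the Calabi-Yau condition provides one that leaves it. *)
Lemma toric_src_surj {Q : quiver} (v : node Q) :
  toric Q -> connected_quiver Q -> 0 < #|arrow Q| -> exists a, src a = v.
Proof.
move=> hQ hconn /card_gt0P[a0 _].
have in_out a : tgt a = v -> exists b, src b = v.
  move=> ta; have : 0 < outdeg v.
    by rewrite -hQ; apply/card_gt0P; exists a; rewrite inE ta.
  by case/card_gt0P => b; rewrite inE => /eqP; exists b.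
have /connectP[p] := hconn (src a0) v.
case: (lastP p) => [_ ->|{}p w]; first by exists a0.
rewrite last_rcons rcons_path => /andP[_ aw] vw.
move: aw; rewrite -vw => /adjacentP[a [[_ /in_out]|[sa _]]] //.
by exists a.
Qed.

(** [pinches] adds operations at the end, whereas the induction below performs a first pinching and
    then recurses. *)
Lemma pinches_cons {L : Type} {P P' : labelled_quiver L} {i j : L}
    {ij : label P i != label P j} {s : seq (L * L)} :
  pinches (pinch ij) s P' -> pinches P ((i, j) :: s) P'.
Proof.
elim=> [|{}s {}P' i' j' ij' _ IH].
  exact: (@pinches_rcons _ P [::] P _ _ ij (pinches_nil P)).
exact: (@pinches_rcons _ P (_ :: _) _ _ _ ij' IH).
Qed.

Lemma bij_morphism_isomorphic {P Q : quiver}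
    {h : node P -> node Q} {c : arrow P -> arrow Q} :
  bijective h -> bijective c ->
  (forall a, h (src a) = src (c a)) -> (forall a, h (tgt a) = tgt (c a)) ->
  isomorphic P Q.
Proof.
move=> h_bij [c' cK c'K] hs ht; exists h => // u v.
have h_inj := bij_inj h_bij.
rewrite /mult -(card_imset _ (can_inj cK)); apply: eq_card => b.
apply/idP/imsetP => [|[a + ->]]; rewrite !inE.
  by move=> uv; exists (c' b); rewrite ?c'K // !inE -!(inj_eq h_inj) hs ht c'K.
by rewrite -hs -ht !(inj_eq h_inj).
Qed.

(** Induction on the number of nodes of [P]: an injective [h] is already an isomorphism, and
    otherwise two nodes with the same image are pinched. *)
Lemma pinches_onto_quotient {L : Type} {P : labelled_quiver L} {Q : quiver}
    {h : node P -> node Q} {c : arrow P -> arrow Q} :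
  (forall u, exists l, label P l = u) -> (forall v, exists u, h u = v) ->
  bijective c ->
  (forall a, h (src a) = src (c a)) -> (forall a, h (tgt a) = tgt (c a)) ->
  exists (s : seq (L * L)) (P' : labelled_quiver L),
    [/\ size s = #|node P| - #|node Q|, pinches P s P' & isomorphic P' Q].
Proof.
have [n] := ubnP #|node P|; elim: n => // n IHn in P h c *.
rewrite ltnS => Pn lab_surj h_surj c_bij hs ht.
have [/injectiveP h_inj|/injectivePn[u [v uv huv]]] := boolP (injectiveb h).
  have h_bij : bijective h.
    apply: inj_card_bij => //; rewrite -(card_codom h_inj).
    apply/subset_leq_card/subsetP => v _.
    by have [u <-] := h_surj v; apply: codom_f.
  exists [::], P; split; last exact: bij_morphism_isomorphic h_bij c_bij hs ht.
    by rewrite (bij_eq_card h_bij) subnn.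
  exact: pinches_nil.
have [[i iu] [j jv]] := (lab_surj u, lab_surj v).
have ij : label P i != label P j by rewrite iu jv.
(* As [h] agrees on the two identified nodes, it factors through [identify] as [h']. *)
pose h' (w : node (pinch ij)) := h (val w).
have h'E w : h' (identify ij w) = h w.
  rewrite /h' /identify val_insubd; case: ifPn => //= /negPn/eqP ->.
  by rewrite iu jv.
have idK (w : node (pinch ij)) : identify ij (val w) = w by apply: valKd.
have card_pinch : #|node P| = #|node (pinch ij)|.+1.
  by rewrite [in RHS]card_sig (cardD1 (label P j)) inE; congr _.+1;
     apply: eq_card => w; rewrite !inE andbT.
have [|w|w|a|a|s [P' [s_size sP iso]]] := IHn (pinch ij) h' c _ _ _ c_bij.
- by rewrite -card_pinch.
- by have [l lw] := lab_surj (val w); exists l; rewrite /= lw idK.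
- by have [x <-] := h_surj w; exists (identify ij x); rewrite h'E.
- by rewrite h'E hs.
- by rewrite h'E ht.
exists ((i, j) :: s), P'; split=> //; last exact: pinches_cons sP.
rewrite /= s_size card_pinch subSn //.
(* A section of [h'] bounds the number of nodes of [Q], so the subtraction is not truncated. *)
have [g gK] : exists g : node Q -> node (pinch ij), forall w, h' (g w) = w.
  have h'_surj w : exists x, h' x == w.
    by have [x <-] := h_surj w; exists (identify ij x); rewrite h'E.
  by exists (fun w => xchoose (h'_surj w)) => w; apply/eqP/(xchooseP (h'_surj w)).
exact: leq_card (can_inj gK).
Qed.

Theorem proposition1 (E G : nat) (hG : 1 <= G) (hGE : G <= E) (Q : quiver)
    (hQ : toric Q) (hconn : connected_quiver Q)
    (hnodes : #|node Q| = G) (harrows : #|arrow Q| = E) :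
  exists (s : seq ('I_E * 'I_E)) (P : labelled_quiver 'I_E),
    [/\ size s = E - G, pinches (polygon E) s P & isomorphic P Q].
Proof.
have E_gt0 : 0 < E by apply: leq_trans hGE.
have [c c_bij c_next] := eulerian_circuit hQ hconn harrows E_gt0.
have [c' cK c'K] := c_bij.
(* Vertex [i] of the polygon is sent to the node from which the circuit takes its arrow [c i]. *)
have [u|v|a|a|s [P [s_size sP iso]]] :=
  @pinches_onto_quotient _ (polygon E) Q (fun i => src (c i)) c _ _ c_bij.
- by exists u.
- have [|a <-] := toric_src_surj v hQ hconn; first by rewrite harrows.
  by exists (c' a); rewrite c'K.
- by [].
- by rewrite c_next.
by exists s, P; split=> //; rewrite s_size hnodes card_ord.
Qed.
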